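(* Let $G$ be a finite simple graph containing a vertex $v$ of degree one, and let $q\ge 3$ be an integer. If $G$ is $q$-solvable, then $G\setminus\{v\}$ (the graph obtained from $G$ by deleting the vertex $v$) is also $q$-solvable.
   Context: Let $G$ be a finite simple graph with vertices $v_1,\ldots,v_n$ and let $[q]=\{1,\ldots,q\}$ be a set of $q$ colors. A coloring is any $x\in[q]^n$, where $x_i$ is the color of $v_i$. A guessing strategy is a choice, for each $i$, of a function $f_i$ with values in $[q]$ depending only on the colors of the neighbors of $v_i$; vertex $v_i$ guesses correctly on $x$ if $f_i(x)=x_i$. $G$ is $q$-solvable if there is a guessing strategy such that for every coloring $x\in[q]^n$ at least one vertex guesses correctly. *)

(* Defs.v *)
From mathcomp Require Import all_boot.

Set Implicit Arguments.
Unset Strict Implicit.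
Unset Printing Implicit Defensive.

Record sgraph := SGraph {
  vertex :> finType;
  adj : rel vertex;
  adj_sym : symmetric adj;
  adj_irr : irreflexive adj
}.

Definition neighbors (G : sgraph) (v : G) : {set G} := [set w | adj v w].

Definition degree (G : sgraph) (v : G) : nat := #|neighbors v|.

Section DeleteVertex.
Variables (G : sgraph) (v : G).

Definition del_adj : rel {x : G | x != v} := fun x y => adj (val x) (val y).

Lemma del_adj_sym : symmetric del_adj.
Proof. by move=> x y; apply: adj_sym. Qed.

Lemma del_adj_irr : irreflexive del_adj.
Proof. by move=> x; apply: adj_irr. Qed.

Definition del_vertex : sgraph := SGraph del_adj_sym del_adj_irr.

End DeleteVertex.

(* The q colors are the elements 0, ..., q - 1 of 'I_q. *)
Definition coloring (G : sgraph) (q : nat) := {ffun G -> 'I_q}.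

(* A family of guessing functions takes whole colorings as input; being a
   guessing strategy means that the guess at v is determined by the colors of
   the neighbors of v. *)
Definition guessing_strategy (G : sgraph) (q : nat)
    (f : G -> coloring G q -> 'I_q) : Prop :=
  forall (v : G) (x y : coloring G q),
    {in neighbors v, x =1 y} -> f v x = f v y.

Definition solvable (G : sgraph) (q : nat) : Prop :=
  exists2 f : G -> coloring G q -> 'I_q,
    guessing_strategy f & forall x : coloring G q, exists v : G, f v x = x v.

(* Main.v *)
Require Import Defs.
From mathcomp Require Import all_boot.

(** Let [u] be the only neighbor of the leaf [v]. In [G] minus [v], every vertex
    other than [u] keeps its guessing function, since [v] is invisible to it;
    only [u] needs a new one. Call a coloring of [G] minus [v] critical if every
    vertex other than [u] guesses wrong on it, so that [u] has to be right. The
    theorem amounts to saying that the color of [u] in a critical coloring is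
    determined by the colors of the neighbors of [u] in [G] minus [v]
    ([critical_color]): then [u] can guess that color.

    Suppose that two critical colorings [x] and [y] agree on these neighbors.
    The guess of [v] depends only on the color of [u], hence takes one value on
    [x] and one on [y]. As there are at least three colors, [v] can be given a
    color [c] different from both values. After extending [x] and [y] by [c],
    every vertex other than [u] is wrong on both, so [u] is right on both; but
    [u] sees the same colors in both, so it makes the same guess, and
    [x u = y u]. *)

Lemma exists_avoiding2 (T : finType) (a b : T) :
  2 < #|T| -> exists2 c, c != a & c != b.
Proof.
move=> T_gt2; have [c]: exists c, c \in ~: [set a; b].
  apply/set0Pn; rewrite -card_gt0 -(ltn_add2l #|[set a; b]|) addn0 cardsC.
  by apply: leq_ltn_trans T_gt2; rewrite cards2; case: (a != b).
by rewrite !inE negb_or => /andP[ca cb]; exists c.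
Qed.

Section ExtendColoring.

Set Implicit Arguments.
Unset Strict Implicit.

Variables (G : sgraph) (v : G) (q : nat).

Local Notation H := (del_vertex v).

Definition extend (c : 'I_q) (x : coloring H q) : coloring G q :=
  [ffun w => if insub w is Some w' then x w' else c].

Lemma extend_val c x (w : H) : extend c x (val w) = x w.
Proof. by rewrite ffunE valK. Qed.

Lemma extend_deleted c x : extend c x v = c.
Proof. by rewrite ffunE insubF ?eqxx. Qed.

Lemma extend_off c d x w : w != v -> extend c x w = extend d x w.
Proof. by move=> wv; rewrite !ffunE insubT. Qed.

Lemma extend_neighbors c (x y : coloring H q) (w : H) :
  {in neighbors w, x =1 y} ->
  {in neighbors (val w), extend c x =1 extend c y}.
Proof.
move=> xy z; rewrite inE => wz; rewrite !ffunE.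
by case: insubP => [z' _ z'z|//]; apply: xy; rewrite inE /= /del_adj z'z.
Qed.

(** A strategy on the whole graph cannot use the color of [v] at a vertex
    that does not see [v]; this includes [v] itself, as loops are excluded. *)
Lemma guess_extend_nonadj f c d x w :
  guessing_strategy f -> ~~ adj w v -> f w (extend c x) = f w (extend d x).
Proof.
move=> f_strat wv; apply: f_strat => z; rewrite inE => wz.
by apply: extend_off; apply: contraNneq wv => <-.
Qed.

End ExtendColoring.

Section Leaf.

Set Implicit Arguments.
Unset Strict Implicit.

Variables (G : sgraph) (v : G) (q : nat).

Local Notation H := (del_vertex v).

Variables (u : H) (f : G -> coloring G q -> 'I_q) (c0 : 'I_q).

Hypothesis q_ge3 : 3 <= q.
Hypothesis neighbors_v : neighbors v = [set val u].
Hypothesis f_strat : guessing_strategy f.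
Hypothesis f_solves : forall x : coloring G q, exists w, f w x = x w.

Lemma nonadj_v (w : H) : w != u -> ~~ adj (val w) v.
Proof.
apply: contraNN; rewrite adj_sym => vw.
have: val w \in neighbors v by rewrite inE.
by rewrite neighbors_v inE.
Qed.

(** The vertices concerned do not see [v], so the choice of [c0] as the color
    of [v] is immaterial. *)
Definition critical (x : coloring H q) :=
  [forall (w : H | w != u), f (val w) (extend c0 x) != x w].

Lemma critical_guess x c :
  critical x -> f v (extend c0 x) != c -> f (val u) (extend c x) = x u.
Proof.
move=> /forall_inP crit_x vc; have [w] := f_solves (extend c x).
have [->|wv] := eqVneq w v.
  rewrite extend_deleted (guess_extend_nonadj _ c0) ?adj_irr // => vE.
  by rewrite vE eqxx in vc.
rewrite -[w]/(val (Sub w wv : H)) extend_val.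
have [-> //|wu] := eqVneq (Sub w wv : H) u.
rewrite (guess_extend_nonadj _ c0) ?nonadj_v // => wE.
by have := crit_x _ wu; rewrite wE eqxx.
Qed.

(** Three colors leave one for [v] on which [v] guesses wrong in both
    colorings, whatever its guesses there are. *)
Lemma critical_color x y :
  critical x -> critical y -> {in neighbors u, x =1 y} -> x u = y u.
Proof.
move=> crit_x crit_y xy.
have colors_gt2 : 2 < #|'I_q| by rewrite card_ord.
have [c cx cy] :=
  exists_avoiding2 _ (f v (extend c0 x)) (f v (extend c0 y)) colors_gt2.
rewrite eq_sym in cx; rewrite eq_sym in cy.
rewrite -(critical_guess crit_x cx) -(critical_guess crit_y cy).
by apply: f_strat; apply: extend_neighbors.
Qed.

Definition agree_at_u (x y : coloring H q) :=
  [forall w in neighbors u, x w == y w].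

Definition new_guess (x : coloring H q) : 'I_q :=
  if [pick y | critical y && agree_at_u x y] is Some y then y u else c0.

Definition leafless_strategy (w : H) (x : coloring H q) : 'I_q :=
  if w == u then new_guess x else f (val w) (extend c0 x).

Lemma leafless_strategyP : guessing_strategy leafless_strategy.
Proof.
move=> w x y; rewrite /leafless_strategy.
case: eqP => [->|_] xy; last by apply: f_strat; apply: extend_neighbors.
rewrite /new_guess (@eq_pick _ _ (fun z => critical z && agree_at_u y z)) //.
by move=> z; congr (_ && _); apply: eq_forallb_in => w' /xy ->.
Qed.

Lemma leafless_strategy_solves x : exists w, leafless_strategy w x = x w.
Proof.
case crit_x: (critical x); last first.
  move: crit_x => /negbT; rewrite negb_forall_in => /exists_inP[w wu].
  by rewrite negbK => /eqP wx; exists w; rewrite /leafless_strategy (negPf wu).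
exists u; rewrite /leafless_strategy eqxx /new_guess.
case: pickP => [y /andP[crit_y /forall_inP xy]|/(_ x)].
  by apply/esym/critical_color => // w /xy /eqP.
by rewrite crit_x => /negP[]; apply/forall_inP.
Qed.

End Leaf.

Theorem theorem1p8 (G : sgraph) (v : G) (q : nat)
    (deg_v : degree v = 1) (q_ge3 : 3 <= q) (G_solvable : solvable G q) :
  solvable (del_vertex v) q.
Proof.
have [f f_strat f_solves] := G_solvable.
have /cards1P[u Nv] : #|neighbors v| == 1 by apply/eqP.
have uv : u != v.
  have: u \in neighbors v by rewrite Nv inE.
  by rewrite inE; apply: contraTneq => ->; rewrite adj_irr.
pose c0 : 'I_q := Ordinal (ltnW (ltnW q_ge3)).
pose u' : del_vertex v := Sub u uv.
exists (leafless_strategy u' f c0).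
  exact: leafless_strategyP.
by move=> x; apply: leafless_strategy_solves.
Qed.
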